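(* Let $V_0>0$. Consider a double linear policy with $\alpha\in(0,1)$ and weights $w(k)\in\mathcal{W}$ for all $k$. Then the expected cumulative gain-loss function is given by $$\overline{\mathcal{G}}(\alpha,\boldsymbol{w},k,\mu)=V_0\left(\alpha\,\overline{R}_+(k)+(1-\alpha)\,\overline{R}_-(k)-1\right).$$ Moreover, when $\alpha=1/2$ and $w(k)\in\mathcal{W}$ with at least two weights being strictly positive (that is, $w(i),w(j)>0$ for some $i\neq j$ in $\{0,1,\dots,k-1\}$), the robust positive expectation (RPE) property holds; i.e., $\overline{\mathcal{G}}(\alpha,\boldsymbol{w},k,\mu)>0$ for $k>1$ and all $\mu\neq 0$.
   Context: Setting. For stages $k=0,1,2,\dots$, a risky asset has price $S(k)>0$ and per-period return $X(k):=\frac{S(k+1)-S(k)}{S(k)}$. With probability one $X(k)\in[X_{\min},X_{\max}]$ for all $k$, with known bounds $-1<X_{\min}<0<X_{\max}<\infty$ that are in the support of $X(k)$. The returns $X(k)$ are independent with common mean $\mathbb{E}[X(k)]=\mu\in\mathbb{R}$ and common variance $\mathrm{var}(X(k))=\sigma^2>0$ for all $k$. Trades incur zero transaction costs, the asset is perfectly liquid, and the riskless rate is taken to be $0$. Admissible weights: $\mathcal{W}:=[0,w_{\max}]$ with $w_{\max}:=\min\{1,1/X_{\max}\}$. The weighting function satisfies $w(k)\in\mathcal{W}$ for all $k$, may vary with $k$, and is assumed to be causal; i.e., it may depend only on the information up to stage $k-1$. Write $\boldsymbol{w}:=\{w(j)\}_{j=0}^{k-1}$. Double linear policy: the initial account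 value $V_0>0$ is split as $V_L(0):=\alpha V_0$ (long) and $V_S(0):=(1-\alpha)V_0$ (short). The policy is $\pi(k):=\pi_L(k)+\pi_S(k)$ with $\pi_L(k)=w(k)V_L(k)$ and $\pi_S(k)=-w(k)V_S(k)$, and the account values evolve as $V_L(k+1)=V_L(k)+X(k)\pi_L(k)$ and $V_S(k+1)=V_S(k)+X(k)\pi_S(k)$. The overall account value is $V(k)=V_L(k)+V_S(k)=V_0(\alpha R_+(k)+(1-\alpha)R_-(k))$, where $R_+(k):=\prod_{j=0}^{k-1}(1+w(j)X(j))$ and $R_-(k):=\prod_{j=0}^{k-1}(1-w(j)X(j))$. Notation: $\overline{R}_+(k):=\mathbb{E}[R_+(k)]$ and $\overline{R}_-(k):=\mathbb{E}[R_-(k)]$. For $k>0$, the cumulative gain-loss function up to stage $k$ is $\mathcal{G}(\alpha,\boldsymbol{w},k,X):=V(k)-V_0$ with $X:=\{X(j)\}_{j=0}^{k-1}$, and its expectation is $\overline{\mathcal{G}}(\alpha,\boldsymbol{w},k,\mu):=\mathbb{E}[\mathcal{G}(\alpha,\boldsymbol{w},k,X)]$. A trading policy is said to have the robust positive expectation (RPE) property if it ensures that the expected cumulative gain-loss $\mathbb{E}[V(k)]-V_0$ is strictly positive for all $k>1$ and under all market conditions.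
   Formalization: The robust positive expectation part is stated for deterministic (possibly stage-varying) weights only; for causal weights that depend on past returns the claim is false, e.g. when the next weight is large after a loss and small after a gain. *)

(* Defs.v *)
From HB Require Import structures.
From mathcomp Require Import all_boot all_order all_algebra.
From mathcomp Require Import all_classical all_reals all_analysis.

Set Implicit Arguments.
Unset Strict Implicit.
Unset Printing Implicit Defensive.

Import Order.TTheory GRing.Theory Num.Theory.
Import numFieldNormedType.Exports.

Local Open Scope classical_set_scope.
Local Open Scope ring_scope.

Definition per_period_return {T : Type} {R : realType} (S : nat -> T -> R)
    (k : nat) (t : T) : R :=
  (S k.+1 t - S k t) / S k t.

(* The product rule for every finite subfamily. *)
Definition mutually_independent {d : measure_display} {T : measurableType d}
    {R : realType} (P : probability T R) (X : nat -> T -> R) : Prop :=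
  forall (J : seq nat) (B : nat -> set R), uniq J ->
    (forall j, measurable (B j)) ->
    P (\big[setI/setT]_(j <- J) (X j @^-1` B j)) =
    (\prod_(j <- J) P (X j @^-1` B j))%E.

(* [x] lies in the topological support of the law of [X] under [P]. *)
Definition in_support {d : measure_display} {T : measurableType d}
    {R : realType} (P : probability T R) (X : T -> R) (x : R) : Prop :=
  forall e : R, 0 < e -> (0 < P (X @^-1` ball x e))%E.

(* The sigma-algebra generated by X(0), ..., X(k-1); it is trivial at k = 0. *)
Definition past {d : measure_display} {T : measurableType d} {R : realType}
    (X : nat -> T -> R) (k : nat) : set (set T) :=
  <<s [set A | exists j (B : set R),
         [/\ (j < k)%N, measurable B & A = X j @^-1` B]] >>.

Definition causal {d : measure_display} {T : measurableType d} {R : realType}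
    (X w : nat -> T -> R) : Prop :=
  forall k (B : set R), measurable B -> past X k (w k @^-1` B).

Definition w_max {R : realType} (Xmax : R) : R := Num.min 1 Xmax^-1.

Definition admissible {R : realType} (Xmax x : R) : Prop :=
  0 <= x <= w_max Xmax.

(* V(j+1) = V(j) + X(j) * pi(j), where the amount invested pi(j) is w(j) V(j) on
   the long side and - w(j) V(j) on the short side. *)
Fixpoint V_long {T : Type} {R : realType} (V0 alpha : R) (w X : nat -> T -> R)
    (k : nat) (t : T) : R :=
  if k is j.+1 then
    let V := V_long V0 alpha w X j t in V + X j t * (w j t * V)
  else alpha * V0.

Fixpoint V_short {T : Type} {R : realType} (V0 alpha : R) (w X : nat -> T -> R)
    (k : nat) (t : T) : R :=
  if k is j.+1 then
    let V := V_short V0 alpha w X j t in V + X j t * (- w j t * V)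
  else (1 - alpha) * V0.

Definition account_value {T : Type} {R : realType} (V0 alpha : R)
    (w X : nat -> T -> R) (k : nat) (t : T) : R :=
  V_long V0 alpha w X k t + V_short V0 alpha w X k t.

Definition gain_loss {T : Type} {R : realType} (V0 alpha : R)
    (w X : nat -> T -> R) (k : nat) (t : T) : R :=
  account_value V0 alpha w X k t - V0.

Definition R_plus {T : Type} {R : realType} (w X : nat -> T -> R)
    (k : nat) (t : T) : R :=
  \prod_(0 <= j < k) (1 + w j t * X j t).

Definition R_minus {T : Type} {R : realType} (w X : nat -> T -> R)
    (k : nat) (t : T) : R :=
  \prod_(0 <= j < k) (1 - w j t * X j t).

(* Main.v *)
Require Import Defs.
From HB Require Import structures.
From mathcomp Require Import all_boot all_order all_algebra.
From mathcomp Require Import all_classical all_reals all_analysis.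
From mathcomp Require Import measurable_realfun ring lra.

(** The account is V0 (alpha R_plus + (1 - alpha) R_minus), so the first claim
    is linearity of expectation. What has to be checked is integrability: a
    weight in [0, min(1, 1/Xmax)] and a return in [Xmin, Xmax] with Xmin > -1
    have a product of absolute value at most 1, whence the products R_plus and
    R_minus of k factors are almost surely bounded by 2^k.

    For the second claim the weights are deterministic numbers v j, so the
    factors 1 + v j X(j) are independent and E[R_plus] is the product p of the
    1 + v j mu, while E[R_minus] is the product q of the 1 - v j mu. Writing
    a j = v j mu, the half-sum (p + q)/2 is the sum of the elementary symmetric
    functions of even degree in the a j. All a j have the sign of mu, so each of
    these is nonnegative; degree 0 contributes 1 and degree 2 contributes at
    least a i * a j > 0 for the two positive weights (prod1D_prod1B_gt2).

    The product rule for expectations (expectation_prod_indep) is derived from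
    the product rule for events. The nonnegative functions of the X(j) are
    obtained from indicators one index at a time: if
    E[g 1_B(Y)] = c P(Y in B) for every Borel set B, then
    E[g f(Y)] = c E[f(Y)] for every nonnegative Borel f (integral_mul_comp).
    The premise is the product rule with an indicator at that index; since the
    rule for events covers all Borel sets, no argument on generated
    sigma-algebras is needed. *)

Set Implicit Arguments.
Unset Strict Implicit.
Unset Printing Implicit Defensive.

Import Order.TTheory GRing.Theory Num.Theory.
Import numFieldNormedType.Exports.

Local Open Scope classical_set_scope.
Local Open Scope ring_scope.

(** * Extension from indicators to nonnegative functions *)

Section MeasureLemmas.
Context d (T : measurableType d) (R : realType) (mu : {measure set T -> \bar R}).
Import HBNNSimple.

Lemma integral_mul_nnsfun_comp (h Y : T -> R) (phi : {nnsfun R >-> R}) :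
  measurable_fun setT h -> (forall t, 0 <= h t) -> measurable_fun setT Y ->
  (\int[mu]_t (h t * phi (Y t))%:E =
   \sum_(y \in range phi)
     (y%:E * \int[mu]_t (h t * \1_(phi @^-1` [set y]) (Y t))%:E))%E.
Proof.
move=> mh h0 mY.
have mI y : measurable_fun setT (fun t => h t * \1_(phi @^-1` [set y]) (Y t)).
  apply: measurable_funM => //; apply: measurableT_comp mY.
  apply: measurable_indic; exact: measurable_funPTI.
have I0 y t : 0 <= h t * \1_(phi @^-1` [set y]) (Y t).
  by rewrite mulr_ge0.
transitivity (\int[mu]_t (\sum_(y \in range phi)
    (y%:E * (h t * \1_(phi @^-1` [set y]) (Y t))%:E)))%E.
  apply: eq_integral => t _; rewrite fimfunE.
  rewrite fsbig_finite//= mulr_sumr -sumEFin fsbig_finite//=.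
  by apply: eq_bigr => y _; rewrite -EFinM mulrCA.
rewrite ge0_integral_fsum//.
- apply: eq_fsbigr => y /set_mem [x _ <-].
  by rewrite ge0_integralZl_EFin//; [move=> t _; rewrite lee_fin|exact/measurable_EFinP].
- by move=> y; apply: measurable_funeM; exact/measurable_EFinP.
- move=> y t _; rewrite -EFinM lee_fin mulrCA mulr_ge0//.
  have := nnfun_muleindic_ge0 phi y (Y t).
  by rewrite -EFinM lee_fin.
Qed.

(** The set functions B |-> integral of g 1_B(Y) and B |-> c mu(Y in B) are
    measures on the line; they agree, hence so do the integrals of f against
    them: first for simple f, then for increasing limits of such. *)
Lemma integral_mul_comp (g Y : T -> R) (c : R) (f : R -> R) :
  measurable_fun setT g -> (forall t, 0 <= g t) -> measurable_fun setT Y ->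
  0 <= c ->
  (forall B : set R, measurable B ->
    \int[mu]_t (g t * \1_B (Y t))%:E = c%:E * mu (Y @^-1` B))%E ->
  measurable_fun setT f -> (forall x, 0 <= f x) ->
  (\int[mu]_t (g t * f (Y t))%:E = c%:E * \int[mu]_t (f (Y t))%:E)%E.
Proof.
move=> mg g0 mY c0 gB mf f0.
have mf' : measurable_fun setT (EFin \o f) by exact/measurable_EFinP.
pose phi := nnsfun_approx measurableT mf'.
have phi_step n : (\int[mu]_t (g t * phi n (Y t))%:E =
    c%:E * \int[mu]_t (phi n (Y t))%:E)%E.
  rewrite integral_mul_nnsfun_comp//.
  under [X in (_ * X)%E]eq_integral do rewrite -[phi n _]mul1r.
  rewrite (integral_mul_nnsfun_comp _ (h := cst 1))//.
  (* a negative y is not a value of phi n, so its term vanishes *)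
  rewrite ge0_mule_fsumr; last first.
    move=> y; have [y0|y0] := leP 0 y.
      apply: mule_ge0; first by rewrite lee_fin.
      by apply: integral_ge0 => t _; rewrite lee_fin mul1r.
    rewrite preimage_nnfun0//.
    by under eq_integral do rewrite indic0 mulr0; rewrite integral0 mule0.
  apply: eq_fsbigr => y _.
  have mB : measurable (phi n @^-1` [set y]).
    by exact: measurable_funPTI.
  have mYB : measurable (Y @^-1` (phi n @^-1` [set y])).
    by rewrite -[X in measurable X]setTI; exact: mY.
  rewrite gB// muleCA; congr (_ * (_ * _))%E.
  under eq_integral do rewrite mul1r.
  rewrite -[X in mu X]setIT -(integral_indic mu measurableT mYB).
  exact: eq_integral.
have mphi n : measurable_fun setT (fun t => phi n (Y t)).
  by apply: measurableT_comp mY; exact: measurable_funP.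
have cvg_phi t : EFin (phi n (Y t)) @[n --> \oo] --> (f (Y t))%:E.
  by apply: (cvg_nnsfun_approx _ mf') => // x _ /=; rewrite lee_fin.
have nd_phi t : {homo (fun n => phi n (Y t)) : m n / (m <= n)%N >-> m <= n}.
  by move=> m n mn; exact/lefP/nd_nnsfun_approx.
have cvgl : (\int[mu]_t (g t * phi n (Y t))%:E)%E @[n --> \oo] -->
    (\int[mu]_t (g t * f (Y t))%:E)%E.
  have -> : (\int[mu]_t (g t * f (Y t))%:E =
      \int[mu]_t limn (fun n => (g t * phi n (Y t))%:E))%E.
    apply: eq_integral => t _; apply/esym/cvg_lim => //.
    under eq_fun do rewrite EFinM.
    by rewrite EFinM; apply: cvgeZl => //; exact: cvg_phi.
  apply: cvg_monotone_convergence => //.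
  - by move=> n; apply/measurable_EFinP; exact: measurable_funM.
  - by move=> n t _; rewrite lee_fin mulr_ge0.
  - by move=> t _ m n mn; rewrite lee_fin ler_wpM2l// nd_phi.
have cvgr : (\int[mu]_t (phi n (Y t))%:E)%E @[n --> \oo] -->
    (\int[mu]_t (f (Y t))%:E)%E.
  have -> : (\int[mu]_t (f (Y t))%:E =
      \int[mu]_t limn (fun n => (phi n (Y t))%:E))%E.
    by apply: eq_integral => t _; apply/esym/cvg_lim => //; exact: cvg_phi.
  apply: cvg_monotone_convergence => //.
  - by move=> n; exact/measurable_EFinP.
  - by move=> n t _; rewrite lee_fin.
  - by move=> t _ m n mn; rewrite lee_fin nd_phi.
have cvgl' : (\int[mu]_t (g t * phi n (Y t))%:E)%E @[n --> \oo] -->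
    (c%:E * \int[mu]_t (f (Y t))%:E)%E.
  rewrite (funext phi_step : (fun n => _) = _).
  by apply: cvgeZl.
by move/cvg_lim: cvgl => <-//; move/cvg_lim: cvgl' => <-.
Qed.

End MeasureLemmas.

(** * Expectation of a product of independent factors *)

Section Independence.
Context d (T : measurableType d) (R : realType) (P : probability T R).
Variable X : nat -> T -> R.
Hypothesis X_indep : mutually_independent P X.
Hypothesis mX : forall j, measurable_fun setT (X j).

(** The form of the product rule on which the induction runs: the indices in r
    still carry indicators and those in s carry arbitrary functions. The empty
    s is the hypothesis of independence. To add an index a to s, the statement
    for s and a :: r is used with an arbitrary Borel set at a, which is the
    premise of integral_mul_comp for the remaining factor g. *)
Lemma expectation_prod_indic_indep (f : nat -> R -> R) (B : nat -> set R)
    (s r : seq nat) :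
  (forall j, measurable_fun setT (f j)) -> (forall j x, 0 <= f j x) ->
  (forall j, j \in s -> \int[P]_t (f j (X j t))%:E \is a fin_num)%E ->
  (forall j, measurable (B j)) -> uniq (s ++ r) ->
  (\int[P]_t ((\prod_(j <- s) f j (X j t)) *
              \prod_(j <- r) \1_(B j) (X j t))%:E =
   (\prod_(j <- s) \int[P]_t (f j (X j t))%:E) *
   \prod_(j <- r) P (X j @^-1` B j))%E.
Proof.
move=> mf f0; elim: s r B => [|a s IH] r B /= finf mB.
  move=> ur; rewrite big_nil mul1e -X_indep//.
  have mpre : measurable (\big[setI/setT]_(j <- r) (X j @^-1` B j)).
    elim/big_ind : _ => //; first exact: measurableI.
    by move=> j _; rewrite -[X in measurable X]setTI; exact: mX.
  rewrite -[X in P X]setIT -(integral_indic P measurableT mpre).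
  apply: eq_integral => t _; rewrite big_nil mul1r; congr EFin.
  elim: {ur mpre} r => [|j r IHr]; first by rewrite !big_nil indicT.
  by rewrite !big_cons indicI IHr.
move=> /andP[]; rewrite mem_cat negb_or => /andP[a_s a_r] usr.
set c := (\prod_(j <- s) \int[P]_t (f j (X j t))%:E *
          \prod_(j <- r) P (X j @^-1` B j))%E.
have c_fin : c \is a fin_num.
  rewrite fin_numM//.
    rewrite big_seq; elim/big_ind : _ => //; first by move=> *; rewrite fin_numM.
    by move=> j js; apply: finf; rewrite inE js orbT.
  elim/big_ind : _ => //; first by move=> *; rewrite fin_numM.
  by move=> j _; apply: fin_num_measure; rewrite -[X in measurable X]setTI; exact: mX.
have c_ge0 : (0 <= c)%E.
  apply: mule_ge0; apply: prode_ge0 => j _ //.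
  by apply: integral_ge0 => t _; rewrite lee_fin.
pose g t := (\prod_(j <- s) f j (X j t)) * \prod_(j <- r) \1_(B j) (X j t).
transitivity (\int[P]_t (g t * f a (X a t))%:E)%E.
  by apply: eq_integral => t _; rewrite big_cons [in RHS]mulrC /g mulrA.
rewrite (@integral_mul_comp _ _ _ P g (X a) (fine c)) //.
- by rewrite fineK// big_cons /c muleC muleA.
- apply: measurable_funM; apply: measurable_prod => j _.
    exact: measurableT_comp.
  by apply: measurableT_comp => //; exact: measurable_indic.
- by move=> t; rewrite mulr_ge0// prodr_ge0.
- exact: fine_ge0.
- move=> C mC; rewrite fineK//.
  pose B' j := if j == a then C else B j.
  have B'a : B' a = C by rewrite /B' eqxx.
  have eqB' : {in r, B' =1 B}.
    by move=> j jr; rewrite /B'; case: eqP => // ja; rewrite -ja jr in a_r.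
  have := IH (a :: r) B'.
  rewrite big_cons B'a.
  have -> : (\prod_(j <- r) P (X j @^-1` B' j) = \prod_(j <- r) P (X j @^-1` B j))%E.
    by rewrite big_seq [RHS]big_seq; apply: eq_bigr => j jr; rewrite eqB'.
  rewrite /c -muleA (muleC _ (P (X a @^-1` C))) => <- //.
  + apply: eq_integral => t _; rewrite /g big_cons B'a -mulrA; congr (_ * _)%:E.
    rewrite mulrC; congr (_ * _).
    by rewrite big_seq [RHS]big_seq; apply: eq_bigr => j jr; rewrite eqB'.
  + by move=> j js; apply: finf; rewrite inE js orbT.
  + by move=> j; rewrite /B'; case: ifP.
  + by rewrite uniq_catC /= mem_cat negb_or a_s a_r/= uniq_catC.
Qed.

Lemma expectation_prod_indep (f : nat -> R -> R) (s : seq nat) :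
  (forall j, measurable_fun setT (f j)) -> (forall j x, 0 <= f j x) ->
  (forall j, j \in s -> 'E_P[f j \o X j] \is a fin_num)%E ->
  uniq s ->
  ('E_P[fun t => (\prod_(j <- s) f j (X j t))%R] = \prod_(j <- s) 'E_P[f j \o X j])%E.
Proof.
move=> mf f0; rewrite unlock => finf us.
have := @expectation_prod_indic_indep f (fun=> setT) s [::] mf f0 finf.
rewrite big_nil mule1 cats0 => <- //.
by apply: eq_integral => t _; rewrite big_nil mulr1.
Qed.

End Independence.

(** * Closed form of the account value *)

Section DoubleLinear.
Context (T : Type) (R : realType).
Implicit Types w X : nat -> T -> R.

Lemma V_longE (V0 alpha : R) w X k t :
  V_long V0 alpha w X k t = V0 * (alpha * R_plus w X k t).
Proof.
rewrite /R_plus; elim: k => [|k IH] /=; first by rewrite big_geq// mulr1 mulrC.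
by rewrite big_nat_recr//= IH; ring.
Qed.

Lemma V_shortE (V0 alpha : R) w X k t :
  V_short V0 alpha w X k t = V0 * ((1 - alpha) * R_minus w X k t).
Proof.
rewrite /R_minus; elim: k => [|k IH] /=; first by rewrite big_geq// mulr1 mulrC.
by rewrite big_nat_recr//= IH; ring.
Qed.

Lemma gain_lossE (V0 alpha : R) w X k t :
  gain_loss V0 alpha w X k t =
  V0 * (alpha * R_plus w X k t + (1 - alpha) * R_minus w X k t - 1).
Proof. by rewrite /gain_loss /account_value V_longE V_shortE; ring. Qed.

Lemma R_minusE w X : R_minus w X = R_plus (fun j t => - w j t) X.
Proof.
by apply/funext => k; apply/funext => t; apply: eq_bigr => j _; rewrite mulNr.
Qed.

End DoubleLinear.

(** * An inequality between products *)

(** With p, q the two partial products, multiplying by the factors at m sends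
    (p + q, p - q) to ((p + q) + a m (p - q), (p - q) + a m (p + q)). Both
    coordinates are therefore nondecreasing from (2, 0); the first positive
    a i makes p - q positive, and the second one then makes p + q exceed 2. *)
Lemma prod1D_prod1B_gt2 (R : realDomainType) (a : nat -> R) (i j n : nat) :
  (forall l, 0 <= a l) -> (i < j < n)%N -> 0 < a i -> 0 < a j ->
  2 < \prod_(0 <= l < n) (1 + a l) + \prod_(0 <= l < n) (1 - a l).
Proof.
move=> a_ge0 /andP[ij jn] ai aj.
pose p m := \prod_(0 <= l < m) (1 + a l).
pose q m := \prod_(0 <= l < m) (1 - a l).
have sumS m : p m.+1 + q m.+1 = (p m + q m) + a m * (p m - q m).
  by rewrite /p /q !big_nat_recr//=; ring.
have diffS m : p m.+1 - q m.+1 = (p m - q m) + a m * (p m + q m).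
  by rewrite /p /q !big_nat_recr//=; ring.
have [sum_ge2 diff_ge0] : (forall m, 2 <= p m + q m) /\ (forall m, 0 <= p m - q m).
  suff H m : 2 <= p m + q m /\ 0 <= p m - q m by split=> m; have [] := H m.
  elim: m => [|m [s2 d0]]; first by rewrite /p /q !big_geq// subrr.
  rewrite sumS diffS; split; first by rewrite ler_wpDr// mulr_ge0.
  by rewrite addr_ge0// mulr_ge0// (le_trans _ s2).
have sum_nd : {homo (fun m => p m + q m) : m m' / (m <= m')%N >-> m <= m'}.
  by apply/nondecreasing_seqP => m; rewrite sumS lerDl mulr_ge0.
have diff_nd : {homo (fun m => p m - q m) : m m' / (m <= m')%N >-> m <= m'}.
  by apply/nondecreasing_seqP => m; rewrite diffS lerDl mulr_ge0// (le_trans _ (sum_ge2 m)).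
have diff_gt0 : 0 < p j - q j.
  apply: lt_le_trans (diff_nd _ _ ij); rewrite diffS ltr_wpDl// mulr_gt0//.
  exact: lt_le_trans (sum_ge2 i).
apply: lt_le_trans (sum_nd _ _ jn); rewrite sumS.
by apply: ltr_pwDr => //; exact: mulr_gt0.
Qed.

(** The case mu < 0 follows from the case mu > 0, since changing the sign of mu
    exchanges the two products. *)
Lemma prod1DM_prod1BM_gt2 (R : realDomainType) (v : nat -> R) (mu : R) (i j n : nat) :
  (forall l, 0 <= v l) -> mu != 0 -> i != j -> (i < n)%N -> (j < n)%N ->
  0 < v i -> 0 < v j ->
  2 < \prod_(0 <= l < n) (1 + v l * mu) + \prod_(0 <= l < n) (1 - v l * mu).
Proof.
move=> v0; wlog ij : i j / (i < j)%N.
  move=> H mu0 ij iN jN vi vj; have [lij|lji|/eqP] := ltngtP i j; last by rewrite (negbTE ij).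
    exact: (H i j).
  by apply: (H j i) => //; rewrite eq_sym.
move=> mu0 _ _ jn vi vj; wlog mu_gt0 : mu mu0 / 0 < mu.
  move=> H; have [mu_lt0|/H|mu_eq0] := ltgtP mu 0; last by rewrite mu_eq0 eqxx in mu0.
    rewrite addrC; under eq_bigr do rewrite -mulrN.
    under [X in _ < _ + X]eq_bigr do rewrite -[_ * mu]opprK -mulrN.
    by apply: H; rewrite ?oppr_eq0// oppr_gt0.
  exact.
apply: (@prod1D_prod1B_gt2 _ (fun l => v l * mu) i j n); rewrite ?ij ?mulr_gt0//.
by move=> l; rewrite mulr_ge0// ltW.
Qed.

(** * Measurability, integrability and expectation of the gain *)

(** The upper bound is x Xmax <= 1 and the lower one x Xmin >= - x >= -1: this is
    what the two terms of the minimum w_max are for. *)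
Lemma admissible_bound (R : realType) (Xmin Xmax x y : R) :
  -1 < Xmin -> 0 < Xmax -> admissible Xmax x -> Xmin <= y <= Xmax ->
  `|x * y| <= 1.
Proof.
move=> Xm X0 /andP[x0]; rewrite /w_max le_min => /andP[x1 xX] /andP[y1 y2].
have xX1 : x * Xmax <= 1 by rewrite -ler_pdivlMr// mul1r.
by rewrite ler_norml; apply/andP; split; nra.
Qed.

Section Integrability.
Context d (T : measurableType d) (R : realType) (P : probability T R).

Lemma Lfun1_ae_bounded (f : T -> R) (M : R) :
  measurable_fun setT f -> {ae P, forall t, `|f t| <= M} -> f \in Lfun P 1.
Proof.
move=> mf fM; apply/Lfun1_integrable/integrableP; split.
  exact/measurable_EFinP.
apply: (@le_lt_trans _ _ (`|M|%:E * P setT)%E); last first.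
  by rewrite probability_setT mule1 ltry.
apply: integral_le_bound => //; first exact/measurable_EFinP.
by apply: filterS fM => t ft _; rewrite /= lee_fin (le_trans ft)// ler_norm.
Qed.

Lemma Lfun1_prod1D (u : nat -> T -> R) (k : nat) :
  (forall j, measurable_fun setT (u j)) ->
  {ae P, forall t, forall j, `|u j t| <= 1} ->
  (fun t => \prod_(0 <= j < k) (1 + u j t)) \in Lfun P 1.
Proof.
move=> mu u1; apply: (@Lfun1_ae_bounded _ (2 ^+ k)).
  by apply: measurable_prod => j _; exact: measurable_funD.
apply: filterS u1 => t ut; rewrite normr_prod.
rewrite -[X in _ <= _ ^+ X]subn0 -prodr_const_nat ler_prod// => j _.
rewrite normr_ge0 (le_trans (ler_normD _ _))// normr1.
by have := ut j; lra.
Qed.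

Lemma measurable_per_period_return (S : nat -> {RV P >-> R}) (k : nat) :
  (forall j t, 0 < S j t) ->
  measurable_fun setT (per_period_return (fun j => S j : T -> R) k).
Proof.
move=> S_gt0; rewrite /per_period_return; apply: measurable_funM.
  exact: measurable_funB.
(* on positive reals the inverse is the power -1, a measurable function *)
rewrite (_ : (fun _ => _) = (fun x : R => x `^ (-1)) \o S k); last first.
  by apply/funext => t /=; rewrite powR_inv1// ltW.
by apply: measurableT_comp => //; exact: measurable_powR.
Qed.

Lemma causal_measurable (X w : nat -> T -> R) (k : nat) :
  (forall j, measurable_fun setT (X j)) -> causal X w ->
  measurable_fun setT (w k).
Proof.
move=> mX w_causal _ B mB; rewrite setTI.
apply: (@smallest_sub _ _ _ (@measurable _ T)) (w_causal k B mB).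
  exact: sigma_algebra_measurable.
by move=> _ [j [C [_ mC ->]]]; rewrite -[X in measurable X]setTI; exact: mX.
Qed.

(** The product rule is for nonnegative functions, whereas 1 + v j x is
    nonnegative only at the values that X j almost surely takes; hence the
    truncation f, which does not change any of the expectations. *)
Lemma expectation_R_plus (X w : nat -> T -> R) (v : nat -> R) (mu : R) (k : nat) :
  mutually_independent P X -> (forall j, measurable_fun setT (X j)) ->
  (forall j, X j \in Lfun P 1) -> (forall j, 'E_P[X j] = mu%:E)%E ->
  (forall j t, w j t = v j) ->
  {ae P, forall t, forall j, `|w j t * X j t| <= 1} ->
  ('E_P[R_plus w X k] = (\prod_(0 <= j < k) (1 + v j * mu))%:E)%E.
Proof.
move=> X_indep mX LX EX wv wX1.
pose f j x := Num.max 0 (1 + v j * x) : R.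
have mf j : measurable_fun setT (f j).
  by apply: measurable_maxr => //; exact: measurable_funD.
have f0 j x : 0 <= f j x by rewrite le_max lexx.
have fX : {ae P, forall t, forall j, f j (X j t) = 1 + v j * X j t}.
  apply: filterS wX1 => t wX1 j; apply/max_idPr.
  by have := wX1 j; rewrite wv ler_norml => /andP[+ _]; lra.
have Ef j : ('E_P[f j \o X j] = (1 + v j * mu)%:E)%E.
  transitivity ('E_P[(cst 1 \+ (v j \o* X j))%R])%E.
    rewrite unlock; apply: ae_eq_integral => //.
    - by apply/measurable_EFinP; exact: measurableT_comp.
    - apply/measurable_EFinP; apply: measurable_funD => //.
      exact: measurable_funM.
    - by apply: filterS fX => t fXt _ /=; rewrite fXt (mulrC (X j t)).
  rewrite expectationD ?Lfun_cst//; last by rewrite Lfun_scale.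
  by rewrite expectation_cst expectationZl// EX.
transitivity ('E_P[fun t => (\prod_(0 <= j < k) f j (X j t))%R])%E.
  rewrite unlock; apply: ae_eq_integral => //.
  - apply/measurable_EFinP/measurable_prod => j _.
    apply: measurable_funD => //; apply: measurable_funM => //.
    by rewrite (_ : w j = cst (v j))//; apply/funext.
  - apply/measurable_EFinP/measurable_prod => j _.
    exact: measurableT_comp.
  - apply: filterS fX => t fXt _ /=; congr EFin.
    by apply: eq_bigr => j _; rewrite fXt wv.
rewrite expectation_prod_indep// ?iota_uniq//; last by move=> j _; rewrite Ef.
by rewrite -prodEFin; apply: eq_bigr => j _; exact: Ef.
Qed.

End Integrability.

Lemma expectation_gain_loss d (T : measurableType d) (R : realType)
    (P : probability T R) (V0 alpha : R) (w X : nat -> T -> R) (k : nat) :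
  R_plus w X k \in Lfun P 1 -> R_minus w X k \in Lfun P 1 ->
  ('E_P[gain_loss V0 alpha w X k] =
   V0%:E * (alpha%:E * 'E_P[R_plus w X k] +
            (1 - alpha)%:E * 'E_P[R_minus w X k] - 1))%E.
Proof.
move=> Lp Lm.
have Lap : alpha \o* R_plus w X k \in Lfun P 1 by rewrite Lfun_scale.
have Lam : (1 - alpha) \o* R_minus w X k \in Lfun P 1 by rewrite Lfun_scale.
have -> : gain_loss V0 alpha w X k = V0 \o* ((alpha \o* R_plus w X k) \+
    ((1 - alpha) \o* R_minus w X k) \- cst 1).
  by apply/funext => t; rewrite gain_lossE /=; ring.
have L1 : cst 1 \in Lfun P 1 by exact: Lfun_cst.
have Ls : (alpha \o* R_plus w X k) \+ ((1 - alpha) \o* R_minus w X k) \in Lfun P 1.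
  exact: rpredD.
rewrite expectationZl; last exact: rpredB.
by rewrite expectationB// expectationD// !expectationZl// expectation_cst.
Qed.

(** * Robust positive expectation *)

Theorem mainTheorem1 (d : measure_display) (T : measurableType d)
    (R : realType) (P : probability T R)
    (S : nat -> {RV P >-> R}) (Xmin Xmax mu sigma : R)
    (X := per_period_return (fun k => S k : T -> R))
    (S_gt0 : forall k t, 0 < S k t)
    (Xmin_gtN1 : -1 < Xmin) (Xmin_lt0 : Xmin < 0) (Xmax_gt0 : 0 < Xmax)
    (X_bounded : {ae P, forall t, forall k, Xmin <= X k t <= Xmax})
    (X_support : forall k, in_support P (X k) Xmin /\ in_support P (X k) Xmax)
    (X_indep : mutually_independent P X)
    (X_mean : forall k, ('E_P[X k] = mu%:E)%E)
    (sigma_gt0 : 0 < sigma)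
    (X_var : forall k, ('V_P[X k] = (sigma ^+ 2)%:E)%E)
    (V0 : R) (V0_gt0 : 0 < V0)
    (w : nat -> T -> R)
    (w_adm : forall k t, admissible Xmax (w k t))
    (w_causal : causal X w)
    (k : nat) :
  (forall alpha : R, 0 < alpha < 1 -> (0 < k)%N ->
     ('E_P[gain_loss V0 alpha w X k] =
      V0%:E * (alpha%:E * 'E_P[R_plus w X k] +
               (1 - alpha)%:E * 'E_P[R_minus w X k] - 1))%E) /\
  (forall v : nat -> R, (forall j t, w j t = v j) ->
     (exists i j : 'I_k, [/\ i != j, 0 < v i & 0 < v j]) ->
     (1 < k)%N -> mu != 0 ->
     (0 < 'E_P[gain_loss V0 2^-1 w X k])%E).
Proof.
have mX j : measurable_fun setT (X j) by exact: measurable_per_period_return.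
have mw j : measurable_fun setT (w j) by exact: causal_measurable w_causal.
have wX1 : {ae P, forall t, forall j, `|w j t * X j t| <= 1}.
  apply: filterS X_bounded => t Xt j.
  exact: (admissible_bound Xmin_gtN1 Xmax_gt0 (w_adm j t) (Xt j)).
have NwX1 : {ae P, forall t, forall j, `|- w j t * X j t| <= 1}.
  by apply: filterS wX1 => t + j => /(_ j); rewrite mulNr normrN.
have LX j : X j \in Lfun P 1.
  apply: (@Lfun1_ae_bounded _ _ _ _ _ (1 + Xmax)) => //.
  apply: filterS X_bounded => t /(_ j) /andP[? ?].
  by rewrite ler_norml; apply/andP; split; lra.
have Lp : R_plus w X k \in Lfun P 1.
  by apply: Lfun1_prod1D => // j; exact: measurable_funM.
have Lm : R_minus w X k \in Lfun P 1.
  rewrite R_minusE; apply: (Lfun1_prod1D (u := fun j t => - w j t * X j t)) => // j.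
  by apply: measurable_funM => //; exact: measurable_funN.
split=> [alpha _ _|v wv [i [j [ij vi vj]]] _ mu0].
  exact: expectation_gain_loss.
(* the weights are deterministic, so any outcome shows that they are >= 0 *)
have v0 l : 0 <= v l.
  by rewrite -(wv l point); have /andP[] := w_adm l point.
rewrite expectation_gain_loss// (expectation_R_plus (v := v) k X_indep mX LX X_mean)//.
(* R_minus is R_plus for the opposite weights *)
rewrite R_minusE (expectation_R_plus (v := fun l => - v l) k X_indep mX LX X_mean)//; last first.
  by move=> l t; rewrite wv.
rewrite -!EFinM lte_fin mulr_gt0//.
under [X in _ + _ * X]eq_bigr do rewrite mulNr.
have := prod1DM_prod1BM_gt2 v0 mu0 ij (ltn_ord i) (ltn_ord j) vi vj.
lra.
Qed.
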